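(* Let $f:\mathbb{R}^n\to\mathbb{R}$ be differentiable, and let $\mathbf{M},\mathbf{G}\in\mathbb{R}^{n\times n}$ be symmetric positive definite matrices such that for all $x,h\in\mathbb{R}^n$ $$f(x)+\langle\nabla f(x),h\rangle+\tfrac12\langle h,\mathbf{G}h\rangle\;\le\; f(x+h)\;\le\; f(x)+\langle\nabla f(x),h\rangle+\tfrac12\langle h,\mathbf{M}h\rangle .$$ Let $x^*$ be the unique minimizer of $f$. Let $c\ge 1$ be an integer and let $\hat S$ be a sampling that is proper and non-vacuous. Let $\hat S^k_i$ ($k\ge 0$, $1\le i\le c$) be independent random sets, each with the same distribution as $\hat S$. Define $$\lambda=\lambda_{\max}\left(\mathbf{G}^{-1/2}\mathbf{M}\mathbf{G}^{-1/2}\right),\qquad \theta=\lambda_{\max}\left(\mathbf{G}^{1/2}\mathbb{E}\left[(\mathbf{M}_{\hat S})^{-1}\right]\mathbf{G}^{1/2}\right),\qquad \sigma_1=\lambda_{\min}\left(\mathbf{G}^{1/2}\mathbb{E}\left[(\mathbf{M}_{\hat S})^{-1}\right]\mathbf{G}^{1/2}\right).$$ Let $b$ be a real number with $b\ge (c-1)\lambda\theta+1$. Given $x^0\in\mathbb{R}^n$, let $$x^{k+1}=x^k-\frac1b\sum_{i=1}^c (\mathbf{M}_{\hat S^k_i})^{-1}\nabla f(x^k),\qquad k=0,1,2,\dots$$ Then for every $k\ge 0$, $$\mathbb{E}\left[f(x^{k+1})-f(x^* )\right]\le (1-\sigma_p)\,\mathbb{E}\left[f(x^k)-f(x^* )\right],\qquad\text{where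 } \sigma_p=\frac{c\,\sigma_1}{b};$$ in particular, $\sigma_p=\frac{c\sigma_1}{1+\theta\lambda(c-1)}$ when $b=(c-1)\lambda\theta+1$.
   Context: A sampling $\hat S$ is a random variable whose values are subsets of $[n]=\{1,\dots,n\}$. It is proper if $\mathbb{P}(i\in\hat S)>0$ for all $i\in[n]$, and non-vacuous if $\mathbb{P}(\hat S=\emptyset)=0$. For nonempty $S\subseteq[n]$, $\mathbf{I}_{:S}$ is the $n\times|S|$ matrix formed by the columns of the $n\times n$ identity matrix indexed by $S$. For $\mathbf{M}\in\mathbb{R}^{n\times n}$ positive definite, $\mathbf{M}_{SS}=\mathbf{I}_{:S}^\top\mathbf{M}\mathbf{I}_{:S}$ is the principal submatrix, and $(\mathbf{M}_S)^{-1}$ denotes the $n\times n$ matrix $\mathbf{I}_{:S}(\mathbf{M}_{SS})^{-1}\mathbf{I}_{:S}^\top$ (inverse of the submatrix placed back at the positions in $S\times S$, zeros elsewhere). $\langle\cdot,\cdot\rangle$ is the standard Euclidean inner product; $\lambda_{\max},\lambda_{\min}$ denote the largest and smallest eigenvalue of a symmetric matrix. *)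

(* Defs.v *)
From HB Require Import structures.
From mathcomp Require Import all_boot all_order all_algebra finmap.
From mathcomp Require Import all_classical all_reals all_analysis.

Set Implicit Arguments.
Unset Strict Implicit.
Unset Printing Implicit Defensive.

Import Order.TTheory GRing.Theory Num.Theory.
Import numFieldNormedType.Exports.

Local Open Scope classical_set_scope.
Local Open Scope ring_scope.

HB.instance Definition _ (I : finType) := isPointed.Build {set I} finset.set0.
HB.instance Definition _ (I : finType) :=
  @isMeasurable.Build default_measure_display {set I}
    discrete_measurable discrete_measurable0
    discrete_measurableC discrete_measurableU.

(* Mutual independence: the product rule over every finite subfamily. *)
Definition mutually_independent (d d' : measure_display)
    (T : measurableType d) (T' : measurableType d') (R : realType)
    (P : probability T R) (I : choiceType) (X : I -> {RV P >-> T'}) : Prop :=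
  forall (J : {fset I}) (B : I -> set T'),
    (forall j, measurable (B j)) ->
    P (\bigcap_(j in [set` J]) (X j @^-1` B j)) =
    (\prod_(j <- J) P (X j @^-1` B j))%E.

Definition proper_sampling (d : measure_display) (T : measurableType d)
    (R : realType) (P : probability T R) (n : nat)
    (S : {RV P >-> {set 'I_n}}) : Prop :=
  forall i : 'I_n, (0 < P [set w | i \in S w])%E.

Definition nonvacuous_sampling (d : measure_display) (T : measurableType d)
    (R : realType) (P : probability T R) (n : nat)
    (S : {RV P >-> {set 'I_n}}) : Prop :=
  P [set w | S w = finset.set0] = 0%E.

Definition expectation_mx (d : measure_display) (T : measurableType d)
    (R : realType) (P : probability T R) (m n : nat)
    (A : T -> 'M[R]_(m, n)) : 'M[R]_(m, n) :=
  \matrix_(i, j) fine 'E_P[fun w => A w i j].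

Definition inner (R : realType) (n : nat) (u v : 'cV[R]_n) : R :=
  \sum_i u i 0 * v i 0.

Definition gradient (R : realType) (n : nat) (f : 'cV[R]_n -> R)
    (x : 'cV[R]_n) : 'cV[R]_n :=
  \col_i 'D_(delta_mx i 0) f x.

Definition posdefmx (R : realType) (n : nat) (A : 'M[R]_n) : Prop :=
  A^T = A /\ forall v : 'cV[R]_n, v != 0 -> 0 < inner v (A *m v).

(* Chosen by [xget]: a positive definite A has exactly one positive definite
   square root; for other A the value is irrelevant. *)
Definition sqrtmx (R : realType) (n : nat) (A : 'M[R]_n) : 'M[R]_n :=
  xget 0 [set B : 'M[R]_n | posdefmx B /\ B *m B = A].

(* The spectrum is finite, and it is nonempty for symmetric A with n > 0, so
   [sup] and [inf] are then a maximum and a minimum. *)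
Definition lambda_max (R : realType) (n : nat) (A : 'M[R]_n) : R :=
  sup [set a : R | eigenvalue A a].

Definition lambda_min (R : realType) (n : nat) (A : 'M[R]_n) : R :=
  inf [set a : R | eigenvalue A a].

(* The columns of the identity indexed by S, in increasing order. *)
Definition idcols (R : realType) (n : nat) (S : {set 'I_n}) : 'M[R]_(n, #|S|) :=
  colsub (@enum_val 'I_n (mem S)) 1%:M.

Definition principal_submx (R : realType) (n : nat) (M : 'M[R]_n)
    (S : {set 'I_n}) : 'M[R]_#|S| :=
  (idcols R S)^T *m M *m idcols R S.

Definition inv_principal (R : realType) (n : nat) (M : 'M[R]_n)
    (S : {set 'I_n}) : 'M[R]_n :=
  idcols R S *m invmx (principal_submx M S) *m (idcols R S)^T.

(* Main.v *)
Require Import Defs.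
From HB Require Import structures.
From mathcomp Require Import all_boot all_order all_algebra finmap.
From mathcomp Require Import all_classical all_reals all_analysis.
From mathcomp Require Import ring lra.

Set Implicit Arguments.
Unset Strict Implicit.
Unset Printing Implicit Defensive.

Import Order.TTheory GRing.Theory Num.Theory.
Import numFieldNormedType.Exports.

Local Open Scope classical_set_scope.
Local Open Scope ring_scope.

(** Write W_S for the inverse of the principal submatrix M_SS put back at the
    positions S x S, E for its mean under the law of the sampling, g for the
    gradient at the current point x, and V for the sum of the c independent
    directions W_{S_i} g.  The upper quadratic model at h = - V / b gives

      f(x + h) <= f(x) - <g, V> / b + <V, M V> / (2 b^2).

    Average over the current draws with x held fixed.  The linear term becomes
    c <g, E g> ([expected_first_order]).  In the quadratic term the c diagonal
    products contribute <g, E g> each, because W_S M W_S = W_S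
    ([inv_principalM]), and the c (c - 1) off-diagonal ones contribute
    <E g, M E g> each, by independence ([expected_second_order]).  Since
    M <= lambda G and E G E <= theta E as quadratic forms
    ([form_le_lambda_max], [form_sandwich_le]), the quadratic term is at most
    c (1 + (c - 1) lambda theta) <g, E g> <= c b <g, E g>, so half of the
    linear gain survives: the mean of f(x + h) is at most
    f(x) - c <g, E g> / (2 b).  Finally <g, E g> >= sigma1 |G^{-1/2} g|^2
    ([lambda_min_le_form]), and minimizing the lower quadratic model over h
    bounds f(x) - min f by half of |G^{-1/2} g|^2
    ([quadratic_lower_bound_gap]).  This is [one_step_decrease].

    Two ingredients surround this computation.

    Spectral theory.  The quantities lambda, theta, sigma1 are extreme
    eigenvalues and G^{1/2} is any positive definite square root, so one needs
    Rayleigh's principle and the existence of the square root.  Both follow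
    from [rayleigh_max]: on the image of a matrix P commuting with a symmetric
    A, the supremum of the Rayleigh quotient is an eigenvalue with an
    eigenvector in that image.  With P = 1 this is Rayleigh's principle; with P
    a polynomial in A it removes eigenvalues one at a time until a product of
    distinct factors A - a vanishes ([sym_split]), after which every function
    of A is obtained by interpolating its values on the spectrum ([sqrtmxP]).

    Probability.  Every x^k is a function of the finitely many draws made
    before time k, and these take finitely many values; all expectations are
    therefore finite sums, and independence says that past and present draws
    have a product law ([expectation_past_present]).  Integrating the one-step
    inequality over the past gives the theorem. *)

(** * Quadratic forms *)

Section Inner.
Variables (R : realType) (n : nat).
Implicit Types (u v w : 'cV[R]_n) (A : 'M[R]_n).

Lemma innerE u v : inner u v = (u^T *m v) 0 0.
Proof. by rewrite mxE; apply: eq_bigr => i _; rewrite mxE. Qed.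

Lemma innerC u v : inner u v = inner v u.
Proof. by apply: eq_bigr => i _; rewrite mulrC. Qed.

Lemma innerDr u v w : inner u (v + w) = inner u v + inner u w.
Proof. by rewrite !innerE mulmxDr mxE. Qed.

Lemma innerDl u v w : inner (v + w) u = inner v u + inner w u.
Proof. by rewrite !(innerC _ u) innerDr. Qed.

Lemma innerZr a u v : inner u (a *: v) = a * inner u v.
Proof. by rewrite !innerE -scalemxAr mxE. Qed.

Lemma innerZl a u v : inner (a *: u) v = a * inner u v.
Proof. by rewrite innerC innerZr innerC. Qed.

Lemma innerNr u v : inner u (- v) = - inner u v.
Proof. by rewrite -scaleN1r innerZr mulN1r. Qed.

Lemma innerNl u v : inner (- u) v = - inner u v.
Proof. by rewrite innerC innerNr innerC. Qed.

Lemma inner0r u : inner u 0 = 0.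
Proof. by rewrite -(scale0r 0) innerZr mul0r. Qed.

Lemma inner_sumr (I : Type) (r : seq I) (Q : pred I) u (F : I -> 'cV[R]_n) :
  inner u (\sum_(i <- r | Q i) F i) = \sum_(i <- r | Q i) inner u (F i).
Proof.
apply: (big_morph (inner u)) => [v w|]; [exact: innerDr | exact: inner0r].
Qed.

Lemma inner_suml (I : Type) (r : seq I) (Q : pred I) u (F : I -> 'cV[R]_n) :
  inner (\sum_(i <- r | Q i) F i) u = \sum_(i <- r | Q i) inner (F i) u.
Proof. by rewrite innerC inner_sumr; apply: eq_bigr => i _; rewrite innerC. Qed.

Lemma inner_ge0 v : 0 <= inner v v.
Proof. by apply: sumr_ge0 => i _; rewrite -expr2 sqr_ge0. Qed.

Lemma inner_eq0 v : (inner v v == 0) = (v == 0).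
Proof.
apply/eqP/eqP => [v0|->]; last exact: inner0r.
apply/matrixP => i j; rewrite (ord1 j) mxE; apply/eqP; rewrite -sqrf_eq0 expr2.
have /psumr_eq0P : forall i : 'I_n, true -> 0 <= v i 0 * v i 0.
  by move=> k _; rewrite -expr2 sqr_ge0.
by move=> /(_ v0 i isT) ->.
Qed.

Lemma inner_gt0 v : (0 < inner v v) = (v != 0).
Proof. by rewrite lt_def inner_ge0 andbT inner_eq0. Qed.

End Inner.

Lemma inner_mull (R : realType) (m n : nat) (A : 'M[R]_(m, n)) u v :
  inner (A *m u) v = inner u (A^T *m v).
Proof. by rewrite !innerE trmx_mul mulmxA. Qed.

Section Symmetric.
Variables (R : realType) (n : nat).
Implicit Types (u v w : 'cV[R]_n) (A B P : 'M[R]_n).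

Lemma inner_sym A u v : A^T = A -> inner (A *m u) v = inner u (A *m v).
Proof. by move=> As; rewrite inner_mull As. Qed.

(** The form of A need not be positive everywhere: nonnegativity on the line
    v + s u is what makes the discriminant of s |-> <v + s u, A (v + s u)>
    nonpositive.  The weak hypothesis is what allows the use of this inequality
    on a proper subspace. *)
Lemma cauchy_schwarz_form A u v : A^T = A ->
    (forall s : R, 0 <= inner (v + s *: u) (A *m (v + s *: u))) ->
  inner u (A *m v) ^+ 2 <= inner u (A *m u) * inner v (A *m v).
Proof.
move=> As Apos.
have Auv : inner v (A *m u) = inner u (A *m v) by rewrite innerC inner_sym.
pose p := Poly [:: inner v (A *m v); 2 * inner u (A *m v); inner u (A *m u)].
have : p`_1 ^+ 2 - 4 * p`_2 * p`_0 <= 0.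
  apply: deg_le2_poly_ge0 => [|s]; first exact: size_Poly.
  rewrite horner_Poly /= mul0r add0r; have := Apos s.
  rewrite mulmxDr -scalemxAr innerDl !innerDr !innerZl !innerZr Auv.
  by congr (0 <= _); ring.
by rewrite !coef_Poly /=; lra.
Qed.

Lemma cauchy_schwarz u v : inner u v ^+ 2 <= inner u u * inner v v.
Proof.
have := @cauchy_schwarz_form 1%:M u v; rewrite !mul1mx; apply.
  exact: trmx1.
by move=> s; rewrite mul1mx inner_ge0.
Qed.

(** If 0 <= B <= C as forms on the vectors concerned, then B^2 <= C B there:
    Cauchy-Schwarz for the form of B at B v and v gives
    |B v|^4 <= <B v, B (B v)> <v, B v>, and one factor |B v|^2 cancels. *)
Lemma form_sqr_le B v C : B^T = B ->
    (forall s : R,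
      0 <= inner (v + s *: (B *m v)) (B *m (v + s *: (B *m v)))) ->
    inner (B *m v) (B *m (B *m v)) <= C * inner (B *m v) (B *m v) ->
  inner (B *m v) (B *m v) <= C * inner v (B *m v).
Proof.
move=> Bs Bpos Bub.
have [Bv0|Bv0] := eqVneq (B *m v) 0; first by rewrite Bv0 !inner0r mulr0.
have vBv : 0 <= inner v (B *m v).
  by have := Bpos 0; rewrite scale0r addr0.
have := cauchy_schwarz_form Bs Bpos.
rewrite -inner_gt0 in Bv0; move=> CS.
rewrite -(ler_pM2l Bv0) -[leLHS]expr2; apply: (le_trans CS).
by rewrite mulrCA mulrA ler_wpM2r.
Qed.

End Symmetric.

Lemma mulmx_bounded (R : realType) (m n : nat) (A : 'M[R]_(m, n)) :
  exists2 C : R, 0 < C &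
    forall v, inner (A *m v) (A *m v) <= C * inner v v.
Proof.
have rowE i (v : 'cV[R]_n) : (A *m v) i 0 = inner (row i A)^T v.
  by rewrite mxE; apply: eq_bigr => j _; rewrite !mxE.
(* the squared Frobenius norm, with 1 added to make it positive *)
exists (1 + \sum_i inner (row i A)^T (row i A)^T).
  by rewrite ltr_wpDr// sumr_ge0// => i _; exact: inner_ge0.
move=> v; rewrite mulrDl mul1r mulr_suml; apply: ler_wpDl; first exact: inner_ge0.
by apply: ler_sum => i _; rewrite !rowE -expr2; exact: cauchy_schwarz.
Qed.

Lemma form_bounded (R : realType) (n : nat) (A : 'M[R]_n) :
  exists2 C : R, 0 < C & forall v, inner v (A *m v) <= C * inner v v.
Proof.
have [C C0 AC] := mulmx_bounded A; exists (1 + C) => [|v]; first lra.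
have := AC v; have := inner_ge0 (v - A *m v).
have := inner_ge0 (A *m v); have := inner_ge0 v.
rewrite innerDl !innerDr !innerNl !innerNr (innerC (A *m v) v); nra.
Qed.

(** * Rayleigh's principle for symmetric matrices *)

(** The row spaces satisfy the inclusion dual to that of the kernels. *)
Lemma ker_factor (R : fieldType) (m p n : nat)
    (X : 'M[R]_(m, n)) (Y : 'M[R]_(p, n)) :
  (forall v : 'cV[R]_n, X *m v = 0 -> Y *m v = 0) -> exists L, Y = L *m X.
Proof.
move=> XY; apply/submxP; rewrite submxE; apply/eqP/matrixP => i j.
have /XY /matrixP/(_ i 0) : X *m col j (cokermx X) = 0.
  by rewrite colE mulmxA mulmx_coker mul0mx.
by rewrite colE mulmxA -colE !mxE.
Qed.

(** Let a be the supremum of the Rayleigh quotient of A on the image of P, and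
    B = a - A, which is nonnegative there.  If B had no kernel on the image of
    P, then P = L B P for some L, so |w| <= const |B w| for w in the image of
    P; but |B w|^2 <= const <w, B w> by [form_sqr_le], so the Rayleigh quotient
    would stay below a by a fixed amount.  This replaces the compactness of the
    unit sphere by linear algebra. *)
Lemma rayleigh_max (R : realType) (n : nat) (A P : 'M[R]_n) :
    A^T = A -> A *m P = P *m A -> P != 0 ->
  exists a (v : 'cV_n), [/\ P *m v != 0, A *m (P *m v) = a *: (P *m v) &
    forall u : 'cV_n, inner (P *m u) (A *m (P *m u)) <= a * inner (P *m u) (P *m u)].
Proof.
move=> As AP P0.
pose E := [set r : R | exists2 u : 'cV_n, P *m u != 0 &
  r = inner (P *m u) (A *m (P *m u)) / inner (P *m u) (P *m u)].
have ubE C : ubound E C <-> forall u : 'cV_n,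
    inner (P *m u) (A *m (P *m u)) <= C * inner (P *m u) (P *m u).
  split=> [EC u|EC _ [u u0 ->]]; last by rewrite ler_pdivrMr ?inner_gt0.
  have [->|u0] := eqVneq (P *m u) 0; first by rewrite mulmx0 inner0r mulr0.
  by rewrite -ler_pdivrMr ?inner_gt0//; apply: EC; exists u.
have E0 : E !=set0.
  apply: contrapT => nE; move/eqP: P0; apply.
  apply/matrixP => i j.
  have : P *m delta_mx j 0 = 0 :> 'cV_n.
    by apply/eqP; apply/negPn/negP => Pj; apply: nE; eexists; exists (delta_mx j 0).
  by rewrite -colE => /matrixP/(_ i 0); rewrite !mxE.
have [C _ AC] := form_bounded A.
have Eub : has_ubound E by exists C; apply/ubE => u; exact: AC.
pose a := sup E.
have supE : forall u : 'cV_n,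
    inner (P *m u) (A *m (P *m u)) <= a * inner (P *m u) (P *m u).
  by apply/ubE; exact: sup_upper_bound.
pose B := a%:M - A.
have Bmul v : B *m v = a *: v - A *m v by rewrite mulmxBl mul_scalar_mx.
have BP : B *m P = P *m B by rewrite mulmxBl mulmxBr AP scalar_mxC.
have Bs : B^T = B by rewrite linearB /= tr_scalar_mx As.
suff [v Pv0 BPv] : exists2 v : 'cV_n, P *m v != 0 & B *m (P *m v) = 0.
  exists a, v; split=> //.
  by apply/esym/eqP; rewrite -subr_eq0 -Bmul BPv.
apply: contrapT => noker.
have [L PL] : exists L, P = L *m (B *m P).
  apply: ker_factor => v; rewrite -mulmxA => BPv; apply: contrapT => /eqP Pv.
  by apply: noker; exists v.
have [CL CL0 LC] := mulmx_bounded L.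
have [CB CB0 BC] := form_bounded B.
(* Since P commutes with B, the line through P u in the direction B P u stays
   in the image of P, where B is nonnegative. *)
have gap (u : 'cV_n) :
    inner (P *m u) (P *m u) <= CL * CB * inner (P *m u) (B *m (P *m u)).
  rewrite -mulrA {1 2}PL -!mulmxA; apply: (le_trans (LC _)).
  rewrite ler_pM2l//; apply: form_sqr_le => // s.
  have -> : P *m u + s *: (B *m (P *m u)) = P *m (u + s *: (B *m u)).
    by rewrite mulmxDr -scalemxAr !mulmxA BP.
  by rewrite (Bmul _ (P *m _)) innerDr innerNr innerZr subr_ge0.
have : ubound E (a - (CL * CB)^-1).
  apply/ubE => u; have := gap u; rewrite Bmul innerDr innerNr innerZr.
  by rewrite -ler_pdivrMl ?mulr_gt0// mulrBl; lra.
move=> /(ge_sup E0); rewrite -/a.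
have : 0 < (CL * CB)^-1 by rewrite invr_gt0 mulr_gt0.
lra.
Qed.

Section Spectrum.
Variables (R : realType) (n : nat).
Implicit Types (A : 'M[R]_n.+1).

Lemma sym_eigenvalueP A a : A^T = A ->
  reflect (exists2 v : 'cV[R]_n.+1, A *m v = a *: v & v != 0) (eigenvalue A a).
Proof.
move=> As; apply: (iffP eigenvalueP) => -[v Av v0].
  exists v^T; last by rewrite trmx_eq0.
  by rewrite -[in LHS]As -trmx_mul Av linearZ.
exists v^T; last by rewrite trmx_eq0.
by rewrite -[in LHS]As -trmx_mul Av linearZ.
Qed.

Lemma lambda_maxP A v : A^T = A ->
  inner v (A *m v) <= lambda_max A * inner v v.
Proof.
move=> As.
have [a [w []]] := @rayleigh_max _ _ A 1%:M As (scalar_mxC _ _) (oner_neq0 _).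
rewrite mul1mx => w0 Aw Aa.
have Aub u : inner u (A *m u) <= a * inner u u by have := Aa u; rewrite mul1mx.
apply: (le_trans (Aub v)); rewrite ler_wpM2r ?inner_ge0//.
apply: ub_le_sup; last by apply/sym_eigenvalueP => //; exists w.
exists a => r /= /(sym_eigenvalueP _ As)[u Au u0].
by have := Aub u; rewrite Au innerZr ler_pM2r ?inner_gt0.
Qed.

(** The spectrum of - A is the opposite of that of A. *)
Lemma lambda_minP A v : A^T = A ->
  lambda_min A * inner v v <= inner v (A *m v).
Proof.
move=> As; have Ns : (- A)^T = - A by rewrite linearN /= As.
suff <- : - lambda_max (- A) = lambda_min A.
  by have := lambda_maxP v Ns; rewrite mulNmx innerNr mulNr lerNl.
rewrite /lambda_min /inf; congr (- sup _).
apply/seteqP; split=>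
  [r /(sym_eigenvalueP _ Ns)[u Au u0]|_ [r /(sym_eigenvalueP _ As)[u Au u0] <-]] /=.
  exists (- r); last exact: opprK.
  by apply/sym_eigenvalueP => //; exists u => //; rewrite scaleNr -Au mulNmx opprK.
by apply/sym_eigenvalueP => //; exists u => //; rewrite scaleNr -Au mulNmx.
Qed.

Lemma lambda_min_ge0 A : A^T = A -> (forall v, 0 <= inner v (A *m v)) ->
  0 <= lambda_min A.
Proof.
move=> As Apos; rewrite /lambda_min.
have lb : lbound [set a | eigenvalue A a] 0.
  move=> r /(sym_eigenvalueP _ As)[u Au u0].
  by have := Apos u; rewrite Au innerZr pmulr_lge0 ?inner_gt0.
have [->|/set0P E0] := eqVneq [set a | eigenvalue A a] set0; first by rewrite inf0.
exact: lb_le_inf.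
Qed.

End Spectrum.

(** * Square roots of positive definite matrices *)

Lemma interpolation (F : fieldType) (g : F -> F) (s : seq F) : uniq s ->
  exists q : {poly F}, forall a, a \in s -> q.[a] = g a.
Proof.
elim: s => [|a s IHs] /=; first by exists 0.
move=> /andP[as' /IHs[q qg]].
pose p := \prod_(b <- s) ('X - b%:P).
have pa : p.[a] != 0 by rewrite -/(root p a) root_prod_XsubC.
exists (q + ((g a - q.[a]) / p.[a]) *: p) => b.
rewrite inE hornerD hornerZ => /predU1P[->|bs].
  by rewrite divfK// addrC subrK.
have /rootP -> : root p b by rewrite root_prod_XsubC.
by rewrite mulr0 addr0 qg.
Qed.

Section HornerMx.
Variables (R : realType) (n : nat).
Implicit Types (A : 'M[R]_n.+1) (p : {poly R}).

Lemma horner_mx_eigen A p a (v : 'cV_n.+1) :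
  A *m v = a *: v -> horner_mx A p *m v = p.[a] *: v.
Proof.
move=> Av; elim/poly_ind: p => [|p c IHp].
  by rewrite rmorph0 mul0mx horner0 scale0r.
rewrite rmorphD rmorphM /= horner_mx_X horner_mx_C hornerMXaddC.
by rewrite mulmxDl -mulmxA Av -scalemxAr IHp mul_scalar_mx scalerA scalerDl mulrC.
Qed.

Lemma tr_horner_mx A p : A^T = A -> (horner_mx A p)^T = horner_mx A p.
Proof.
move=> As; elim/poly_ind: p => [|p c IHp]; first by rewrite rmorph0 trmx0.
rewrite rmorphD [in RHS]mulrC !rmorphM /= horner_mx_X horner_mx_C.
by rewrite linearD /= tr_scalar_mx trmx_mul IHp As.
Qed.

(** While P = prod_(a in s) (A - a) is nonzero, [rayleigh_max] gives an
    eigenvector w = P v in its image, with eigenvalue a.  It is new: if a were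
    in s, then P w = 0 and |w|^2 = <P v, w> = <v, P w> = 0.  Adding it to s
    lowers the rank, since v is killed by (A - a) P and not by P. *)
Lemma sym_split A : A^T = A ->
  exists2 s : seq R, uniq s /\ (forall a, a \in s -> eigenvalue A a) &
    horner_mx A (\prod_(a <- s) ('X - a%:P)) = 0.
Proof.
move=> As.
suff ind k s : uniq s -> (forall a, a \in s -> eigenvalue A a) ->
    (\rank (horner_mx A (\prod_(a <- s) ('X - a%:P))) < k)%N ->
  exists2 s : seq R, uniq s /\ (forall a, a \in s -> eigenvalue A a) &
    horner_mx A (\prod_(a <- s) ('X - a%:P)) = 0.
  by apply: (ind _ [::]) => //; exact: ltnSn.
elim: k s => // k IHk s us sA; set p := \prod_(a <- s) _ => rk.
have [P0|P0] := eqVneq (horner_mx A p) 0; first by exists s.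
have AP : A *m horner_mx A p = horner_mx A p *m A.
  by have := congr1 (horner_mx A) (mulrC (polyX R) p);
    rewrite !rmorphM /= horner_mx_X.
have [a [v [Pv0 Aw _]]] := rayleigh_max As AP P0.
set w := horner_mx A p *m v in Pv0 Aw.
have as' : a \notin s.
  apply: contraNN Pv0 => as'.
  rewrite -inner_eq0 {1}/w inner_mull tr_horner_mx// (horner_mx_eigen p Aw).
  have /rootP -> : root p a by rewrite root_prod_XsubC.
  by rewrite scale0r inner0r.
apply: (IHk (a :: s)) => /=.
- by rewrite as'.
- move=> b; rewrite inE => /predU1P[->|/sA//].
  by apply/sym_eigenvalueP => //; exists w.
rewrite ltnS in rk; rewrite big_cons -/p rmorphM; apply: leq_trans rk.
have P'v : horner_mx A ('X - a%:P) *m horner_mx A p *m v = 0.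
  rewrite -mulmxA -/w (horner_mx_eigen _ Aw).
  by rewrite hornerXsubC subrr scale0r.
have : (horner_mx A ('X - a%:P) *m horner_mx A p < horner_mx A p)%MS.
  rewrite /ltmx submxMl; apply: contra Pv0 => /submxP[L PL].
  by rewrite /w PL -mulmxA P'v mulmx0.
by rewrite ltmxErank => /andP[].
Qed.

(** Interpolating the fourth root on the spectrum gives a symmetric C with
    C^4 = A.  Then C^2 is a square root of A, and it is positive definite
    because it equals C^T C with C injective, A being so. *)
Lemma sqrtmxP A : posdefmx A -> posdefmx (sqrtmx A) /\ sqrtmx A *m sqrtmx A = A.
Proof.
move=> [As Apos].
apply: (@xgetPex _ 0 [set B : 'M[R]_n.+1 | posdefmx B /\ B *m B = A]).
have [s [us sA] sA0] := sym_split As.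
have [q qs] := interpolation (fun a => Num.sqrt (Num.sqrt a)) us.
have spos a : a \in s -> 0 < a.
  move=> /sA /(sym_eigenvalueP _ As)[v Av v0].
  by have := Apos v v0; rewrite Av innerZr pmulr_lgt0 ?inner_gt0.
pose C := horner_mx A q.
have CA : C *m C *m (C *m C) = A.
  suff : horner_mx A (q * q * (q * q) - 'X) = 0.
    by rewrite rmorphB !rmorphM /= horner_mx_X => /eqP; rewrite subr_eq0 => /eqP.
  have sroot : all (root (q * q * (q * q) - 'X)) s.
    apply/allP => a as'; apply/rootP.
    rewrite hornerD hornerN hornerX !hornerM qs// -!expr2.
    by rewrite !sqr_sqrtr ?sqrtr_ge0 ?subrr// ltW// spos.
  have [|r ->] := uniq_roots_prod_XsubC sroot; first by rewrite uniq_rootsE.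
  by rewrite rmorphM /= sA0 mulr0.
have Cs : C^T = C by exact: tr_horner_mx.
exists (C *m C); split=> //; split=> [|v v0]; first by rewrite trmx_mul Cs.
rewrite -mulmxA -(inner_sym _ _ Cs) inner_gt0; apply: contraNN v0 => /eqP Cv.
apply/eqP; apply: contrapT => /eqP /Apos.
by rewrite -{1}CA -!mulmxA Cv !mulmx0 inner0r ltxx.
Qed.

End HornerMx.

(** * Inverses of principal submatrices *)

(** A positive definite matrix has no kernel. *)
Lemma posdefmx_unit (R : realType) (n : nat) (A : 'M[R]_n) :
  posdefmx A -> A \in unitmx.
Proof.
move=> [As Apos].
have [L LA] : exists L, 1%:M = L *m A.
  apply: ker_factor => v Av; apply: contrapT; rewrite mul1mx => /eqP /Apos.
  by rewrite Av inner0r ltxx.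
by have [] := mulmx1_unit (esym LA).
Qed.

Section InvPrincipal.
Variables (R : realType) (n : nat) (M : 'M[R]_n).
Hypothesis Mpd : posdefmx M.
Implicit Types (S : {set 'I_n}).

Lemma idcolsK S : (idcols R S)^T *m idcols R S = 1%:M.
Proof.
apply/matrixP => i j; rewrite !mxE (bigD1 (enum_val j)) //= big1.
  by rewrite !mxE eqxx mulr1 addr0 eq_sym (inj_eq enum_val_inj) eq_sym.
by move=> k /negPf kj; rewrite !mxE kj mulr0.
Qed.

Lemma principal_posdef S : posdefmx (principal_submx M S).
Proof.
have [Ms Mpos] := Mpd; split=> [|v v0].
  by rewrite /principal_submx !trmx_mul trmxK Ms mulmxA.
rewrite /principal_submx -!mulmxA innerC inner_mull trmxK innerC; apply: Mpos.
apply: contraNN v0 => /eqP Iv.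
by rewrite -[v]mul1mx -idcolsK -mulmxA Iv mulmx0.
Qed.

Lemma inv_principal_sym S : (inv_principal M S)^T = inv_principal M S.
Proof.
by rewrite /inv_principal !trmx_mul trmxK trmx_inv (principal_posdef S).1 mulmxA.
Qed.

(** The inverse of M_SS meets M only through M_SS, so one factor cancels. *)
Lemma inv_principalM S :
  inv_principal M S *m M *m inv_principal M S = inv_principal M S.
Proof.
have /mulmxV MK := posdefmx_unit (principal_posdef S).
rewrite /inv_principal -!mulmxA; congr (_ *m _).
rewrite !mulmxA -(mulmxA _ (idcols R S)^T M) -(mulmxA _ _ (idcols R S)).
rewrite -/(principal_submx M S).
by rewrite -(mulmxA _ (principal_submx M S)) MK mulmx1.
Qed.

End InvPrincipal.

(** * Comparison of quadratic forms relative to G *)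

Lemma const_mx1_neq0 (R : realType) (n : nat) : const_mx 1 != 0 :> 'cV[R]_n.+1.
Proof.
by apply/eqP => /matrixP/(_ 0 0); rewrite !mxE => /eqP; rewrite oner_eq0.
Qed.

Section Relative.
Variables (R : realType) (n : nat) (G : 'M[R]_n.+1).
Hypothesis Gpd : posdefmx G.
Let Q := sqrtmx G.

Let Qs : Q^T = Q. Proof. by case: (sqrtmxP Gpd) => -[]. Qed.
Let QQ : Q *m Q = G. Proof. by case: (sqrtmxP Gpd). Qed.
Let Qunit : Q \in unitmx.
Proof. by case: (sqrtmxP Gpd) => /posdefmx_unit. Qed.

(** Rayleigh's principle at the vector G^{1/2} u. *)
Lemma form_le_lambda_max (A : 'M[R]_n.+1) (u : 'cV_n.+1) : A^T = A ->
  inner u (A *m u) <= lambda_max (invmx Q *m A *m invmx Q) * inner u (G *m u).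
Proof.
move=> As; set B := invmx Q *m A *m invmx Q.
have Bs : B^T = B by rewrite !trmx_mul trmx_inv Qs As mulmxA.
have := lambda_maxP (Q *m u) Bs.
rewrite inner_sym// inner_sym// !mulmxA QQ.
by rewrite -(mulmxA _ (invmx Q) Q) mulVmx// mulmx1 mulmxV// mul1mx.
Qed.

Lemma sandwich_form (A : 'M[R]_n.+1) (g : 'cV_n.+1) :
  inner (invmx Q *m g) (Q *m A *m Q *m (invmx Q *m g)) = inner g (A *m g).
Proof.
rewrite !mulmxA mulmxK// inner_mull trmx_inv Qs !mulmxA.
by rewrite mulVmx// mul1mx.
Qed.

Lemma sandwich_sym (A : 'M[R]_n.+1) : A^T = A -> (Q *m A *m Q)^T = Q *m A *m Q.
Proof. by move=> As; rewrite !trmx_mul Qs As mulmxA. Qed.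

Lemma sandwich_ge0 (A : 'M[R]_n.+1) (v : 'cV_n.+1) :
    (forall g : 'cV_n.+1, 0 <= inner g (A *m g)) ->
  0 <= inner v (Q *m A *m Q *m v).
Proof. by move=> Apos; rewrite -!mulmxA -inner_sym. Qed.

Lemma lambda_min_le_form (A : 'M[R]_n.+1) (g : 'cV_n.+1) : A^T = A ->
  lambda_min (Q *m A *m Q) * inner (invmx Q *m g) (invmx Q *m g) <=
  inner g (A *m g).
Proof.
by move=> As; rewrite -sandwich_form lambda_minP// sandwich_sym.
Qed.

(** That is, E G E <= theta E.  With K = G^{1/2} A G^{1/2} and
    v = G^{-1/2} g, the two sides are |K v|^2 and theta <v, K v>, so this is
    [form_sqr_le] for K. *)
Lemma form_sandwich_le (A : 'M[R]_n.+1) (g : 'cV_n.+1) : A^T = A ->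
    (forall v : 'cV_n.+1, 0 <= inner v (A *m v)) ->
  inner (A *m g) (G *m (A *m g)) <=
    lambda_max (Q *m A *m Q) * inner g (A *m g).
Proof.
move=> As Apos; have Ks := sandwich_sym As.
rewrite -(sandwich_form A g); set K := Q *m A *m Q in Ks *.
set v := invmx Q *m g.
have Kv : K *m v = Q *m (A *m g) by rewrite /K /v !mulmxA mulmxK.
rewrite -QQ -mulmxA -inner_sym// -Kv.
apply: form_sqr_le => // [s|]; first exact: sandwich_ge0.
exact: lambda_maxP.
Qed.

Lemma lambda_max_rel_ge0 (A : 'M[R]_n.+1) : A^T = A ->
    (forall v : 'cV_n.+1, 0 <= inner v (A *m v)) ->
  0 <= lambda_max (invmx Q *m A *m invmx Q).
Proof.
move=> As Apos; have := form_le_lambda_max (const_mx 1) As.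
have v0 := const_mx1_neq0 R n.
by move=> /(le_trans (Apos _)); rewrite pmulr_lge0//; case: Gpd => _; apply.
Qed.

Lemma lambda_max_sandwich_ge0 (A : 'M[R]_n.+1) : A^T = A ->
    (forall v : 'cV_n.+1, 0 <= inner v (A *m v)) ->
  0 <= lambda_max (Q *m A *m Q).
Proof.
move=> As Apos; have := lambda_maxP (const_mx 1) (sandwich_sym As).
have v0 := const_mx1_neq0 R n.
move=> /(le_trans (sandwich_ge0 _ Apos)).
by rewrite pmulr_lge0// inner_gt0.
Qed.

(** The square |G^{-1/2} g + G^{1/2} h|^2 is nonnegative. *)
Lemma quadratic_lower_bound_gap (g h : 'cV[R]_n.+1) :
  - (2^-1 * inner (invmx Q *m g) (invmx Q *m g)) <=
  inner g h + 2^-1 * inner h (G *m h).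
Proof.
have gh : inner g h = inner (invmx Q *m g) (Q *m h).
  by rewrite inner_mull trmx_inv Qs mulmxA mulVmx// mul1mx.
have hGh : inner h (G *m h) = inner (Q *m h) (Q *m h).
  by rewrite inner_sym// mulmxA QQ.
rewrite gh hGh; have := inner_ge0 (invmx Q *m g + Q *m h).
rewrite innerDl !innerDr (innerC (Q *m h) (invmx Q *m g)); lra.
Qed.

End Relative.


(** * Sums against a finite product law *)

Section ProductSums.
Variables (R : comNzRingType) (I U : finType) (p : U -> R).
Hypothesis p1 : \sum_u p u = 1.

Lemma prod_sum_prod (F : I -> U -> R) :
  \sum_(y : {ffun I -> U}) (\prod_i p (y i)) * \prod_i F i (y i) =
  \prod_i \sum_u p u * F i u.
Proof.
by rewrite bigA_distr_bigA; apply: eq_bigr => y _; rewrite big_split.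
Qed.

Lemma prod_sum_total : \sum_(y : {ffun I -> U}) \prod_i p (y i) = 1.
Proof. by rewrite -(bigA_distr_bigA (fun (_ : I) u => p u)) big1. Qed.

(** The coordinates of y other than i integrate to 1. *)
Lemma prod_sum_marginal (i : I) (phi : U -> R) :
  \sum_(y : {ffun I -> U}) (\prod_k p (y k)) * phi (y i) =
  \sum_u p u * phi u.
Proof.
have := prod_sum_prod (fun k u => if k == i then phi u else 1).
rewrite [RHS](bigD1 i)//= eqxx [X in _ * X]big1 => [|k /negPf ->]; last first.
  by under eq_bigr do rewrite mulr1.
rewrite mulr1 => <-; apply: eq_bigr => y _; congr (_ * _).
by rewrite (bigD1 i)//= eqxx big1 ?mulr1// => k /negPf ->.
Qed.

(** For indicators of single values this is the product rule; a general phi is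
    a linear combination of products of two indicators. *)
Lemma prod_sum_marginal2 (i j : I) (phi : U -> U -> R) : i != j ->
  \sum_(y : {ffun I -> U}) (\prod_k p (y k)) * phi (y i) (y j) =
  \sum_u \sum_v p u * p v * phi u v.
Proof.
move=> ij; have ji : j != i by rewrite eq_sym.
have pair u v : \sum_(y : {ffun I -> U}) (\prod_k p (y k)) *
    ((y i == u)%:R * (y j == v)%:R) = p u * p v.
  have := prod_sum_prod (fun k w => if k == i then (w == u)%:R else
                              if k == j then (w == v)%:R else 1).
  have delta a : \sum_w p w * (w == a)%:R = p a.
    rewrite (bigD1 a)//= eqxx mulr1 big1 ?addr0// => w /negPf ->.
    by rewrite mulr0.
  rewrite [RHS](bigD1 i)//= eqxx delta [X in _ * X](bigD1 j ji) /=.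
  rewrite (negPf ji) eqxx delta.
  rewrite [X in _ * (_ * X)]big1 => [|k /andP[/negPf -> /negPf ->]]; last first.
    by under eq_bigr do rewrite mulr1.
  rewrite mulr1 => <-; apply: eq_bigr => y _; congr (_ * _).
  rewrite (bigD1 i)//= eqxx; congr (_ * _).
  rewrite (bigD1 j ji) /= (negPf ji) eqxx.
  by rewrite big1 ?mulr1// => k /andP[/negPf -> /negPf ->].
under [RHS]eq_bigr do under eq_bigr do rewrite -pair mulr_suml.
under [RHS]eq_bigr do rewrite exchange_big.
rewrite [RHS]exchange_big; apply: eq_bigr => y _ /=.
rewrite (bigD1 (y i))//= (bigD1 (y j))//= !eqxx !mulr1.
rewrite [X in _ + X + _]big1 => [|v /negPf]; last first.
  by rewrite eq_sym => ->; rewrite !(mulr0, mul0r).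
rewrite [X in _ + X]big1 => [|u /negPf]; last first.
  by rewrite eq_sym => ->; rewrite big1// => v _; rewrite !(mulr0, mul0r).
by rewrite !addr0.
Qed.

End ProductSums.

(** * Averaged descent in one step *)

Section Mean.
Variables (R : realType) (n : nat) (M : 'M[R]_n) (U : finType).
Variables (p : U -> R) (W : U -> 'M[R]_n).
Hypotheses (Ms : M^T = M) (Mpos : forall v : 'cV_n, 0 <= inner v (M *m v)).
Hypotheses (p0 : forall u, 0 <= p u) (p1 : \sum_u p u = 1).
Hypotheses (Ws : forall u, (W u)^T = W u).
Hypotheses (WMW : forall u, W u *m M *m W u = W u).
Let E := \sum_u p u *: W u.

Lemma mean_sym : E^T = E.
Proof.
by rewrite linear_sum; apply: eq_bigr => u _; rewrite linearZ /= Ws.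
Qed.

Lemma mean_mul (v : 'cV_n) : E *m v = \sum_u p u *: (W u *m v).
Proof. by rewrite mulmx_suml; apply: eq_bigr => u _; rewrite -scalemxAl. Qed.

Lemma mean_form (v : 'cV_n) : inner v (E *m v) = \sum_u p u * inner v (W u *m v).
Proof.
by rewrite mean_mul inner_sumr; apply: eq_bigr => u _; rewrite innerZr.
Qed.

Lemma form_self_conjugate u (v : 'cV_n) :
  inner (W u *m v) (M *m (W u *m v)) = inner v (W u *m v).
Proof. by rewrite inner_sym// !mulmxA WMW. Qed.

Lemma mean_ge0 (v : 'cV_n) : 0 <= inner v (E *m v).
Proof.
by rewrite mean_form sumr_ge0// => u _; rewrite mulr_ge0// -form_self_conjugate.
Qed.

Lemma expected_first_order (I : finType) (g : 'cV_n) :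
  \sum_(y : {ffun I -> U}) (\prod_i p (y i)) *
     inner g (\sum_i W (y i) *m g) = #|I|%:R * inner g (E *m g).
Proof.
under eq_bigr do rewrite inner_sumr mulr_sumr.
rewrite exchange_big /=.
under eq_bigr do rewrite (prod_sum_marginal p1 _ (fun u => inner g (W u *m g))).
by rewrite sumr_const mulr_natl mean_form.
Qed.

(** The diagonal terms reduce to <g, E g> by [form_self_conjugate]; in each
    of the other terms the two draws are independent, so the bilinear form sees
    their means. *)
Lemma expected_second_order (I : finType) (g : 'cV_n) :
  \sum_(y : {ffun I -> U}) (\prod_i p (y i)) *
     inner (\sum_i W (y i) *m g) (M *m \sum_i W (y i) *m g) =
  #|I|%:R * (inner g (E *m g) +
             #|I|.-1%:R * inner (E *m g) (M *m (E *m g))).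
Proof.
pose B u v := inner (W u *m g) (M *m (W v *m g)).
have BE : \sum_u \sum_v p u * p v * B u v = inner (E *m g) (M *m (E *m g)).
  rewrite mean_mul inner_suml; apply: eq_bigr => u _.
  rewrite mulmx_sumr inner_sumr; apply: eq_bigr => v _.
  by rewrite -scalemxAr innerZl innerZr mulrA.
transitivity (\sum_(i : I) \sum_(j : I) \sum_(y : {ffun I -> U})
    (\prod_k p (y k)) * B (y i) (y j)).
  under [RHS]eq_bigr do rewrite exchange_big.
  rewrite [RHS]exchange_big; apply: eq_bigr => y _ /=.
  rewrite inner_suml mulr_sumr; apply: eq_bigr => i _.
  by rewrite mulmx_sumr inner_sumr mulr_sumr.
have row i : \sum_(j : I) \sum_(y : {ffun I -> U})
    (\prod_k p (y k)) * B (y i) (y j) =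
    inner g (E *m g) + #|I|.-1%:R * inner (E *m g) (M *m (E *m g)).
  rewrite (bigD1 i)//= (prod_sum_marginal p1 i (fun u => B u u)).
  congr (_ + _).
    by rewrite mean_form; apply: eq_bigr => u _; rewrite /B form_self_conjugate.
  rewrite (eq_bigr (fun=> inner (E *m g) (M *m (E *m g)))); last first.
    by move=> j ji; rewrite prod_sum_marginal2// eq_sym.
  by rewrite sumr_const mulr_natl cardC1.
under eq_bigr do rewrite row.
by rewrite sumr_const [RHS]mulr_natl.
Qed.

End Mean.

Section OneStep.
Variables (R : realType) (n : nat) (f : 'cV[R]_n.+1 -> R) (M G : 'M[R]_n.+1).
Hypotheses (Mpd : posdefmx M) (Gpd : posdefmx G).
Variables (U I : finType) (p : U -> R) (W : U -> 'M[R]_n.+1).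
Hypotheses (p0 : forall u, 0 <= p u) (p1 : \sum_u p u = 1).
Hypotheses (Ws : forall u, (W u)^T = W u).
Hypotheses (WMW : forall u, W u *m M *m W u = W u).
Let Q := sqrtmx G.
Let E := \sum_u p u *: W u.
Let lambda := lambda_max (invmx Q *m M *m invmx Q).
Let theta := lambda_max (Q *m E *m Q).
Let sigma := lambda_min (Q *m E *m Q).

(** Here p and W stand for the law of the sampling and for S |-> W_S, whose
    relation to M is the identity W M W = W.  The gap is measured from an
    arbitrary point z, since the lower model bounds f(x) - f(z) for every z. *)
Lemma one_step_decrease (x g z : 'cV[R]_n.+1) (b : R) : (0 < #|I|)%N ->
    (forall h, f x + inner g h + 2^-1 * inner h (G *m h) <= f (x + h)) ->
    (forall h, f (x + h) <= f x + inner g h + 2^-1 * inner h (M *m h)) ->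
    (#|I|%:R - 1) * lambda * theta + 1 <= b ->
  \sum_(y : {ffun I -> U}) (\prod_i p (y i)) *
     (f (x - b^-1 *: \sum_i W (y i) *m g) - f z) <=
  (1 - #|I|%:R * sigma / b) * (f x - f z).
Proof.
move=> I0 lower upper b_ge; have [Ms Mpos'] := Mpd.
have Mpos (v : 'cV_n.+1) : 0 <= inner v (M *m v).
  by have [->|/Mpos'/ltW//] := eqVneq v 0; rewrite mulmx0 inner0r.
have Es : E^T = E by exact: mean_sym.
have Epos (v : 'cV_n.+1) : 0 <= inner v (E *m v) by exact: mean_ge0.
have lambda0 : 0 <= lambda by exact: lambda_max_rel_ge0.
have theta0 : 0 <= theta by exact: lambda_max_sandwich_ge0.
have sigma0 : 0 <= sigma.
  by apply: lambda_min_ge0 => [|v]; [exact: sandwich_sym|exact: sandwich_ge0].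
set c : R := #|I|%:R in b_ge *.
have c1 : 1 <= c by rewrite ler1n.
have cE : #|I|.-1%:R = c - 1 :> R by rewrite -subn1 natrB.
have b1 : 1 <= b.
  by apply: le_trans b_ge; rewrite lerDr !mulr_ge0// subr_ge0.
have b0 : 0 < b by lra.
pose a := inner g (E *m g).
pose m := inner (E *m g) (M *m (E *m g)).
have a0 : 0 <= a by exact: Epos.
have m_le : m <= lambda * theta * a.
  apply: (le_trans (form_le_lambda_max Gpd _ Ms)).
  by rewrite -mulrA ler_wpM2l// form_sandwich_le.
have gap : sigma * (f x - f z) <= 2^-1 * a.
  have := lambda_min_le_form Gpd g Es; rewrite -/Q -/sigma -/a => sa.
  apply: (@le_trans _ _ (2^-1 * (sigma * inner (invmx Q *m g) (invmx Q *m g)))).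
    rewrite mulrCA ler_wpM2l//.
    have := lower (z - x); rewrite (addrC x) subrK.
    have := quadratic_lower_bound_gap Gpd g (z - x); rewrite -/Q; lra.
  by rewrite ler_pM2l// invr_gt0.
have step (y : {ffun I -> U}) : f (x - b^-1 *: \sum_i W (y i) *m g) - f z <=
    (f x - f z) - b^-1 * inner g (\sum_i W (y i) *m g) +
    2^-1 * b^-1 ^+ 2 *
      inner (\sum_i W (y i) *m g) (M *m \sum_i W (y i) *m g).
  have := upper (- (b^-1 *: \sum_i W (y i) *m g)).
  by rewrite mulmxN -scalemxAr !innerNr innerNl innerZl !innerZr; lra.
apply: (@le_trans _ _ ((f x - f z) - b^-1 * (c * a) +
    2^-1 * b^-1 ^+ 2 * (c * (a + (c - 1) * m)))).
  rewrite -cE -expected_first_order// -expected_second_order//.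
  have total : f x - f z =
      \sum_(y : {ffun I -> U}) (\prod_i p (y i)) * (f x - f z).
    by rewrite -mulr_suml prod_sum_total// mul1r.
  rewrite [X in X - _ + _]total !mulr_sumr.
  rewrite -sumrB -big_split; apply: ler_sum => y _ /=.
  have pi0 : 0 <= \prod_i p (y i) by exact: prodr_ge0.
  by have := ler_wpM2l pi0 (step y); lra.
(* b dominates the weight 1 of the diagonal terms plus the weight
   (c - 1) lambda theta of the off-diagonal ones *)
have second : a + (c - 1) * m <= b * a.
  have : 0 <= (c - 1) * (lambda * theta * a - m).
    by rewrite mulr_ge0// subr_ge0.
  have := ler_wpM2r a0 b_ge; lra.
have bV0 : 0 < b^-1 by rewrite invr_gt0.
have c0 : 0 <= c by lra.
have : 2^-1 * b^-1 ^+ 2 * (c * (a + (c - 1) * m)) <= 2^-1 * b^-1 * (c * a).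
  have -> : 2^-1 * b^-1 * (c * a) = 2^-1 * b^-1 ^+ 2 * (c * (b * a)).
    by field; rewrite gt_eqF.
  have half0 : 0 <= 2^-1 * b^-1 ^+ 2 :> R by rewrite mulr_ge0 ?sqr_ge0 ?invr_ge0.
  by apply: ler_wpM2l => //; exact: ler_wpM2l.
have : c * b^-1 * (sigma * (f x - f z)) <= c * b^-1 * (2^-1 * a).
  by rewrite ler_wpM2l// mulr_ge0// ltW.
lra.
Qed.

End OneStep.

(** * Expectations of finite-valued random elements *)

Section FiniteValued.
Context (d : measure_display) (T : measurableType d) (R : realType).
Variable P : probability T R.

Lemma expectation_finite (U : finType) (Z : T -> U) (phi : U -> R) :
    (forall u, measurable [set w | Z w = u]) ->
  ('E_P[fun w => phi (Z w)])%E = (\sum_u phi u * fine (P [set w | Z w = u]))%:E.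
Proof.
move=> mZ; rewrite unlock.
have -> : (fun w => (phi (Z w))%:E) =
    (fun w => (\sum_u (phi u)%:E * (\1_[set w | Z w = u] w)%:E)%E).
  apply/funext => w; rewrite (bigD1 (Z w)) //= big1 => [|u uw].
    by rewrite indicE mem_set// adde0 mule1.
  by rewrite indicE memNset ?mule0//= => /esym/eqP; apply/negP.
rewrite integral_sum//; last first.
  by move=> u; apply: integrableZl => //; exact: integrable_indic.
rewrite -sumEFin; apply: eq_bigr => u _.
rewrite integralZl//; last exact: integrable_indic.
rewrite integral_indic// setIT EFinM fineK//.
exact: fin_num_measure.
Qed.

Lemma sum_fine_law (U : finType) (Z : T -> U) :
    (forall u, measurable [set w | Z w = u]) ->
  \sum_u fine (P [set w | Z w = u]) = 1.
Proof.
move=> mZ; have := @expectation_finite U Z (fun=> 1) mZ.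
rewrite (expectation_cst P 1) => -[->].
by apply: eq_bigr => u _; rewrite mul1r.
Qed.

End FiniteValued.

(** The product rule is given over finite subsets of I; a finite family
    indexed by an injection into I is one of them.  The events outside its image
    are filled in with the full set. *)
Lemma independent_finite_family (d d' : measure_display)
    (T : measurableType d) (T' : measurableType d') (R : realType)
    (P : probability T R) (I : choiceType) (X : I -> {RV P >-> T'})
    (K : finType) (h : K -> I) (A : K -> set T') :
    mutually_independent X -> injective h ->
    (forall k, measurable (A k)) ->
  P [set w | forall k, A k (X (h k) w)] =
  (\prod_k P (X (h k) @^-1` A k))%E.
Proof.
move=> indX hinj mA.
pose B i := if [pick k | h k == i] is Some k then A k else setT.
have Bh k : B (h k) = A k.
  rewrite /B; case: pickP => [k' /eqP/hinj->//|/(_ k)]; by rewrite eqxx.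
have mB i : measurable (B i) by rewrite /B; case: pickP.
pose J := seq_fset tt [seq h k | k <- enum K].
have hu : uniq [seq h k | k <- enum K] by rewrite map_inj_uniq ?enum_uniq.
have := indX J B mB.
rewrite (perm_big [seq h k | k <- enum K]); last first.
  by rewrite (perm_trans (seq_fset_perm _ _))// undup_id.
rewrite big_map big_enum /= => indJ.
transitivity (\prod_k P (X (h k) @^-1` B (h k)))%E; last first.
  by apply: eq_bigr => k _; rewrite Bh.
rewrite -indJ; congr (P _); apply/seteqP; split=> w /= Aw.
  move=> i /=; rewrite seq_fsetE => /mapP[k _ ->]; rewrite /preimage /= Bh.
  exact: Aw.
move=> k; rewrite -Bh; apply: (Aw (h k)).
by rewrite /= seq_fsetE map_f// mem_enum.
Qed.

Lemma measurable_finite_family (d d' : measure_display)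
    (T : measurableType d) (T' : measurableType d') (R : realType)
    (P : probability T R) (K : finType) (X : K -> {RV P >-> T'})
    (A : K -> set T') : (forall k, measurable (A k)) ->
  measurable [set w | forall k, A k (X k w)].
Proof.
move=> mA.
have -> : [set w | forall k, A k (X k w)] =
    \bigcap_(k in [set: K]) (X k @^-1` A k).
  by apply/seteqP; split=> w /= Aw k => [_|]; exact: Aw.
by apply: fin_bigcap_measurable => // k _; exact: measurable_funPTI.
Qed.

(** * Past and present draws *)

Section Samplings.
Variables (R : realType) (n c : nat).
Variables (d0 : measure_display) (T0 : measurableType d0).
Variables (P0 : probability T0 R) (Shat : {RV P0 >-> {set 'I_n}}).
Variables (d : measure_display) (T : measurableType d) (P : probability T R).
Variable Sk : nat -> 'I_c -> {RV P >-> {set 'I_n}}.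
Hypothesis indep : mutually_independent (fun ki : nat * 'I_c => Sk ki.1 ki.2).
Hypothesis law : forall (k : nat) (i : 'I_c) (A : set {set 'I_n}),
  distribution P (Sk k i) A = distribution P0 Shat A.

Definition sampling_law (S : {set 'I_n}) : R := fine (P0 [set w | Shat w = S]).

Lemma sampling_law_ge0 S : 0 <= sampling_law S.
Proof. by rewrite fine_ge0. Qed.

Lemma measurable_sampling S : measurable [set w | Shat w = S].
Proof.
rewrite -[X in measurable X]/(Shat @^-1` [set S]).
exact: measurable_funPTI.
Qed.

Lemma sum_sampling_law : \sum_S sampling_law S = 1.
Proof. exact: (sum_fine_law P0 measurable_sampling). Qed.

Lemma expectation_mx_sampling (W : {set 'I_n} -> 'M[R]_n) :
  expectation_mx P0 (fun w => W (Shat w)) = \sum_S sampling_law S *: W S.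
Proof.
apply/matrixP => i j; rewrite mxE summxE.
rewrite (expectation_finite P0 (fun S => W S i j) measurable_sampling) /=.
by apply: eq_bigr => S _; rewrite mxE mulrC.
Qed.

Lemma family_law (K : finType) (h : K -> nat * 'I_c) (u : K -> {set 'I_n}) :
  injective h ->
  P [set w | forall k, Sk (h k).1 (h k).2 w = u k] =
  (\prod_k sampling_law (u k))%:E.
Proof.
move=> hinj.
rewrite (@independent_finite_family _ _ _ _ _ _ _ _ _ h
  (fun k => [set u k]) indep)//.
rewrite -prodEFin; apply: eq_bigr => k _.
have := law (h k).1 (h k).2 [set u k]; rewrite /distribution /pushforward => ->.
by rewrite fineK// fin_num_measure//; exact: measurable_sampling.
Qed.

Definition past (k : nat) (w : T) : {ffun 'I_k * 'I_c -> {set 'I_n}} :=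
  [ffun ki : 'I_k * 'I_c => Sk ki.1 ki.2 w].

Definition present (k : nat) (w : T) : {ffun 'I_c -> {set 'I_n}} :=
  [ffun i => Sk k i w].

Lemma pastE k z : [set w | past k w = z] =
  [set w | forall ki : 'I_k * 'I_c, Sk ki.1 ki.2 w = z ki].
Proof.
apply/seteqP; split=> w /= => [<- ki|zw]; first by rewrite ffunE.
by apply/ffunP => ki; rewrite ffunE.
Qed.

(** The draws made up to time k, the first summand holding those strictly
    before k: with this index type the joint law of past and present factors
    by splitting a product over a sum type. *)
Definition draw_index k (s : ('I_k * 'I_c) + 'I_c) : nat * 'I_c :=
  match s with inl ki => (val ki.1, ki.2) | inr i => (k, i) end.

Lemma draw_index_inj k : injective (@draw_index k).
Proof.
move=> [[a i]|i] [[b j]|j] //= [].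
- by move=> /val_inj -> ->.
- by move=> ak _; have := ltn_ord a; rewrite ak ltnn.
- by move=> kb _; have := ltn_ord b; rewrite -kb ltnn.
- by move=> ->.
Qed.

Lemma past_presentE k z : [set w | (past k w, present k w) = z] =
  [set w | forall s, Sk (@draw_index k s).1 (draw_index s).2 w =
     match s with inl ki => z.1 ki | inr i => z.2 i end].
Proof.
apply/seteqP; split=> w /= => [<- [ki|i]|zw]; [by rewrite ffunE..|].
case: z zw => z y zw; congr pair; apply/ffunP => s; rewrite ffunE.
  by have := zw (inl s).
by have := zw (inr s).
Qed.

Lemma measurable_past k z : measurable [set w | past k w = z].
Proof.
rewrite pastE.
pose A (ki : 'I_k * 'I_c) : set {set 'I_n} := [set z ki].
exact: (@measurable_finite_family _ _ _ _ _ _ _ (fun ki => Sk (val ki.1) ki.2) A).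
Qed.

Lemma measurable_past_present k z :
  measurable [set w | (past k w, present k w) = z].
Proof.
rewrite past_presentE.
pose A (s : 'I_k * 'I_c + 'I_c) : set {set 'I_n} :=
  [set match s with inl ki => z.1 ki | inr i => z.2 i end].
exact: (@measurable_finite_family _ _ _ _ _ _ _
  (fun s => Sk (draw_index s).1 (draw_index s).2) A).
Qed.

Lemma past_present_law k z :
  fine (P [set w | (past k w, present k w) = z]) =
  fine (P [set w | past k w = z.1]) * \prod_i sampling_law (z.2 i).
Proof.
rewrite past_presentE (family_law _ (@draw_index_inj k)) big_sumType /=.
rewrite pastE; congr (_ * _).
rewrite (@family_law _ (fun ki : 'I_k * 'I_c => (val ki.1, ki.2)))//.
by move=> [a i] [b j] [/val_inj -> ->].
Qed.

Lemma expectation_past k (phi : {ffun 'I_k * 'I_c -> {set 'I_n}} -> R) :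
  ('E_P[fun w => phi (past k w)])%E =
  (\sum_z phi z * fine (P [set w | past k w = z]))%:E.
Proof. exact: (expectation_finite P _ (@measurable_past k)). Qed.

(** This is the tower property: averaging over the present draws with the past
    frozen uses the law of the sampling alone, because the present draws are
    independent of the past and of each other. *)
Lemma expectation_past_present k
    (phi : {ffun 'I_k * 'I_c -> {set 'I_n}} -> {ffun 'I_c -> {set 'I_n}} -> R) :
  ('E_P[fun w => phi (past k w) (present k w)])%E =
  ('E_P[fun w => (\sum_(y : {ffun 'I_c -> {set 'I_n}})
      (\prod_i sampling_law (y i)) * phi (past k w) y)%R])%E.
Proof.
rewrite (expectation_finite P (fun z => phi z.1 z.2) (@measurable_past_present k)).
rewrite (expectation_past (fun z => \sum_(y : {ffun 'I_c -> {set 'I_n}})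
  (\prod_i sampling_law (y i)) * phi z y)).
congr EFin.
under eq_bigr do rewrite past_present_law.
rewrite -(pair_bigA _ (fun z y => phi z y *
  (fine (P [set w | past k w = z]) * \prod_i sampling_law (y i)))) /=.
apply: eq_bigr => z _; rewrite mulr_suml; apply: eq_bigr => y _; ring.
Qed.

End Samplings.

(** * Linear convergence *)

Theorem theorem2 (R : realType) (n : nat)
    (f : 'cV[R]_n -> R) (f_diff : forall x, differentiable f x)
    (M G : 'M[R]_n) (M_pd : posdefmx M) (G_pd : posdefmx G)
    (f_lower : forall x h : 'cV[R]_n,
      f x + inner (gradient f x) h + 2^-1 * inner h (G *m h) <= f (x + h))
    (f_upper : forall x h : 'cV[R]_n,
      f (x + h) <= f x + inner (gradient f x) h + 2^-1 * inner h (M *m h))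
    (xstar : 'cV[R]_n)
    (xstar_min : unique (fun z : 'cV[R]_n => forall y, f z <= f y) xstar)
    (c : nat) (c_ge1 : (1 <= c)%N)
    (* the reference sampling and its law *)
    (d0 : measure_display) (T0 : measurableType d0) (P0 : probability T0 R)
    (Shat : {RV P0 >-> {set 'I_n}})
    (Shat_proper : proper_sampling Shat)
    (Shat_nonvacuous : nonvacuous_sampling Shat)
    (* the independent copies *)
    (d : measure_display) (T : measurableType d) (P : probability T R)
    (Sk : nat -> 'I_c -> {RV P >-> {set 'I_n}})
    (Sk_indep : mutually_independent (fun ki : nat * 'I_c => Sk ki.1 ki.2))
    (Sk_law : forall (k : nat) (i : 'I_c) (A : set {set 'I_n}),
      distribution P (Sk k i) A = distribution P0 Shat A)
    (lambda theta sigma1 : R)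
    (lambda_def : lambda =
      lambda_max (invmx (sqrtmx G) *m M *m invmx (sqrtmx G)))
    (theta_def : theta =
      lambda_max (sqrtmx G *m expectation_mx P0 (fun w => inv_principal M (Shat w))
                  *m sqrtmx G))
    (sigma1_def : sigma1 =
      lambda_min (sqrtmx G *m expectation_mx P0 (fun w => inv_principal M (Shat w))
                  *m sqrtmx G))
    (b : R) (b_ge : (c%:R - 1) * lambda * theta + 1 <= b)
    (x0 : 'cV[R]_n) (x : nat -> T -> 'cV[R]_n)
    (x_init : forall w, x 0%N w = x0)
    (x_step : forall k w, x k.+1 w =
      x k w - b^-1 *: \sum_(i < c) (inv_principal M (Sk k i w) *m gradient f (x k w)))
    (sigma_p : R) (sigma_p_def : sigma_p = c%:R * sigma1 / b) :
  (forall k : nat,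
    ('E_P[fun w => (f (x k.+1 w) - f xstar)%R]
      <= (1 - sigma_p)%:E * 'E_P[fun w => (f (x k w) - f xstar)%R])%E) /\
  (b = (c%:R - 1) * lambda * theta + 1 ->
    sigma_p = c%:R * sigma1 / (1 + theta * lambda * (c%:R - 1))).
Proof.
split; last first.
  move=> bE; rewrite sigma_p_def bE; congr (_ / _); ring.
(* For n = 0 the only set is empty, so the sampling would be vacuous. *)
move=> k; destruct n as [|n].
  have : P0 [set w | Shat w = finset.set0] = 1%E.
    rewrite -(probability_setT P0); congr (P0 _); apply/seteqP; split=> // w _ /=.
    by apply/setP => -[].
  by rewrite Shat_nonvacuous => -[] /esym/eqP; rewrite oner_eq0.
pose next (v : 'cV[R]_n.+1) (y : {ffun 'I_c -> {set 'I_n.+1}}) :=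
  v - b^-1 *: \sum_(i < c) (inv_principal M (y i) *m gradient f v).
have nextE j w : x j.+1 w = next (x j w) (present Sk j w).
  by rewrite x_step /next; under [in RHS]eq_bigr do rewrite ffunE.
have [F xF] : exists F, forall w, x k w = F (past Sk k w).
  elim: k => [|k [F xF]]; first by exists (fun=> x0).
  exists (fun z : {ffun 'I_k.+1 * 'I_c -> {set 'I_n.+1}} =>
    next (F [ffun ki => z (widen_ord (leqnSn k) ki.1, ki.2)])
         [ffun i => z (ord_max, i)]) => w.
  rewrite nextE xF; congr (next (F _) _); apply/ffunP => s; rewrite !ffunE//.
pose gap v := f v - f xstar.
rewrite (_ : (fun w => f (x k.+1 w) - f xstar) =
    (fun w => gap (next (F (past Sk k w)) (present Sk k w)))); last first.
  by apply/funext => w; rewrite nextE xF.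
rewrite (_ : (fun w => f (x k w) - f xstar) =
    (fun w => gap (F (past Sk k w)))); last first.
  by apply/funext => w; rewrite xF.
rewrite (expectation_past_present Sk_indep Sk_law (fun z y => gap (next (F z) y))).
rewrite (expectation_past Sk (fun z => \sum_(y : {ffun 'I_c -> {set 'I_n.+1}})
  (\prod_i sampling_law Shat (y i)) *
  gap (next (F z) y))) (expectation_past Sk (fun z => gap (F z))).
rewrite -EFinM lee_fin mulr_sumr; apply: ler_sum => z _; rewrite mulrA.
apply: ler_wpM2r; first exact: fine_ge0.
have := one_step_decrease (f := f) (I := 'I_c) (x := F z)
  (g := gradient f (F z)) (b := b) M_pd G_pd (sampling_law_ge0 Shat)
  (sum_sampling_law Shat) (inv_principal_sym M_pd) (inv_principalM M_pd) xstar.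
rewrite card_ord -expectation_mx_sampling -lambda_def -theta_def -sigma1_def.
by rewrite -sigma_p_def; apply.
Qed.
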